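(* Let $\Gamma$ be a finite simple graph, and define $\tilde\Gamma^{(0)}=\Gamma$ and, for $i\ge1$, $\tilde\Gamma^{(i)}$ to be the prime graph of $SEP(\tilde\Gamma^{(i-1)})$. Then the SEP $\Gamma$-series has finite length: there exists an integer $m\ge1$ such that $\tilde\Gamma^{(m)}$ has no vertices.
   Context: Two vertices $u,v$ of a graph are structurally equivalent if the transposition $(u\,v)$ (swapping $u,v$, fixing other vertices) is an automorphism; $SEP(\Gamma)=\langle\{(u\,v) : (u\,v)\in \mathrm{Aut}(\Gamma)\}\rangle$. The prime graph of a finite group $G$ has as vertices the primes dividing $|G|$, distinct primes $p,q$ being adjacent iff $G$ has an element of order $pq$ (for the trivial group it has no vertices). The sequence $\tilde\Gamma^{(0)},\tilde\Gamma^{(1)},\dots$ up to the last graph before the empty graph is called the SEP $\Gamma$-series; its last nonempty term is its minimal element. *)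

(* Defs.v *)
From HB Require Import structures.
From mathcomp Require Import all_boot all_fingroup.

Set Implicit Arguments.
Unset Strict Implicit.
Unset Printing Implicit Defensive.

Local Open Scope group_scope.

(* The vertex type is bundled, since it changes along the SEP series. The
   graph with no vertices is allowed. *)
Record sgraph := SGraph {
  vertex : finType;
  adj : rel vertex;
  adj_sym : symmetric adj;
  adj_irrefl : irreflexive adj
}.

Definition graph_aut (G : sgraph) : {set {perm vertex G}} :=
  [set s : {perm vertex G} | [forall u, forall v, adj (s u) (s v) == adj u v]].

Definition struct_equiv (G : sgraph) (u v : vertex G) : bool :=
  tperm u v \in graph_aut G.

(* The degenerate case u = v only adds the identity [tperm u u = 1] to the
   generating set. *)
Definition SEP (G : sgraph) : {group {perm vertex G}} :=
  <<[set s : {perm vertex G} |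
      [exists u, exists v, struct_equiv u v && (s == tperm u v)]]>>%G.

Section PrimeGraph.
Variables (gT : finGroupType) (H : {group gT}).

Definition prime_vertex : finType := seq_sub (primes #|H|).

Definition prime_adj (p q : prime_vertex) : bool :=
  (p != q) && [exists x in H, #[x] == (val p * val q)%N].

Lemma prime_adj_sym : symmetric prime_adj.
Proof. by move=> p q; rewrite /prime_adj eq_sym mulnC. Qed.

Lemma prime_adj_irrefl : irreflexive prime_adj.
Proof. by move=> p; rewrite /prime_adj eqxx. Qed.

Definition prime_graph : sgraph := SGraph prime_adj_sym prime_adj_irrefl.

End PrimeGraph.

Fixpoint SEP_series (G : sgraph) (i : nat) : sgraph :=
  if i is i'.+1 then prime_graph (SEP (SEP_series G i')) else G.

(* Main.v *)
Require Import Defs.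
From HB Require Import structures.
From mathcomp Require Import all_boot all_fingroup.

(** The group SEP of a graph on n vertices embeds in S_n, so every prime dividing
    its order lies in the interval [2, n]. Hence the prime graph has at most n - 1
    vertices, and each step of the series loses a vertex until none is left. *)

Lemma prime_dvd_fact_leq (p n : nat) : prime p -> (p %| n`!)%N -> (p <= n)%N.
Proof.
move=> p_pr; elim: n => [|n IHn]; first by rewrite fact0 Euclid_dvd1.
rewrite factS Euclid_dvdM // => /orP[/dvdn_leq-> // | /IHn le_pn].
exact: leqW.
Qed.

Lemma size_primes_perm_group (T : finType) (H : {group {perm T}}) :
  (size (primes #|H|) <= #|T|.-1)%N.
Proof.
rewrite -(size_iota 2 #|T|.-1); apply: uniq_leq_size (primes_uniq _) _ => p.
rewrite mem_primes mem_iota => /and3P[p_pr _ p_dv_H].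
(* By Lagrange in the full symmetric group, the order of [H] divides [#|T|]!. *)
have sHS : H \subset Sym [set: T].
  by apply/subsetP=> s _; rewrite inE; apply/subsetP=> x _; rewrite inE.
have p_dv_fact : (p %| #|T|`!)%N.
  by rewrite -cardsT -card_Sym (dvdn_trans p_dv_H) // cardSg.
have le_pT := prime_dvd_fact_leq _ _ p_pr p_dv_fact.
have p_gt1 := prime_gt1 p_pr.
(* For empty [T], [#|T|.-1] truncates to 0; there [p <= 0] contradicts [1 < p]. *)
by rewrite p_gt1 add2n; case: #|T| le_pT => [|n] // /(leq_trans p_gt1).
Qed.

(** Truncated subtraction lets the bound persist at 0 once the series is empty. *)
Lemma card_SEP_series (G : sgraph) (i : nat) :
  (#|vertex (SEP_series G i)| <= #|vertex G| - i)%N.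
Proof.
elim: i => [|i IHi]; first by rewrite subn0.
rewrite subnS /= card_seq_sub ?primes_uniq //.
apply: leq_trans (size_primes_perm_group _ _) _.
by rewrite -!subn1 leq_sub2r.
Qed.

Theorem theorem3p6 (G : sgraph) :
  exists m : nat, (1 <= m)%N /\ #|vertex (SEP_series G m)| = 0%N.
Proof.
(* [#|vertex G|] steps already empty the graph; the successor secures [1 <= m] when [G] has no
   vertices. *)
exists #|vertex G|.+1; split=> //; apply/eqP.
by rewrite -leqn0 (leq_trans (card_SEP_series _ _)) // subnS subnn.
Qed.
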